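(* Let $(\mathfrak{g},[\cdot,\cdot,\cdot]_t,\{\cdot,\cdot,\cdot\}_t)$ be an infinitesimal deformation of a compatible $3$-Lie algebra $(\mathfrak{g},[\cdot,\cdot,\cdot],\{\cdot,\cdot,\cdot\})$ generated by $(\omega_1,\omega_2)$. Then $(\omega_1,\omega_2)$ is closed, i.e. $\mathbb{d}^2(\omega_1,\omega_2)=0$. Furthermore, two infinitesimal deformations $(\mathfrak{g},[\cdot,\cdot,\cdot]_t,\{\cdot,\cdot,\cdot\}_t)$ and $(\mathfrak{g},[\cdot,\cdot,\cdot]_t',\{\cdot,\cdot,\cdot\}_t')$ of a compatible $3$-Lie algebra $(\mathfrak{g},[\cdot,\cdot,\cdot],\{\cdot,\cdot,\cdot\})$ generated by $(\omega_1,\omega_2)$ and $(\omega_1',\omega_2')$ respectively are equivalent if and only if $(\omega_1,\omega_2)$ and $(\omega_1',\omega_2')$ are in the same cohomology class in $\mathcal{H}^2(\mathfrak{g},\mathfrak{g})$.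
   Context: All vector spaces are finite-dimensional over an algebraically closed field $\mathbb{K}$ of characteristic $0$. A 3-Lie algebra is a vector space $\mathfrak{g}$ with a skew-symmetric trilinear map $[\cdot,\cdot,\cdot]:\wedge^3\mathfrak{g}\to\mathfrak{g}$ such that $[x_1,x_2,[x_3,x_4,x_5]]=[[x_1,x_2,x_3],x_4,x_5]+[x_3,[x_1,x_2,x_4],x_5]+[x_3,x_4,[x_1,x_2,x_5]]$ for all $x_i\in\mathfrak{g}$. A compatible 3-Lie algebra is a triple $(\mathfrak{g},[\cdot,\cdot,\cdot],\{\cdot,\cdot,\cdot\})$ where $[\cdot,\cdot,\cdot]$ and $\{\cdot,\cdot,\cdot\}$ are 3-Lie algebra structures on $\mathfrak{g}$ such that for all $x_1,\dots,x_5\in\mathfrak{g}$: $[x_1,x_2,\{x_3,x_4,x_5\}]+\{x_1,x_2,[x_3,x_4,x_5]\}=[\{x_1,x_2,x_3\},x_4,x_5]+\{[x_1,x_2,x_3],x_4,x_5\}+[x_3,\{x_1,x_2,x_4\},x_5]+\{x_3,[x_1,x_2,x_4],x_5\}+[x_3,x_4,\{x_1,x_2,x_5\}]+\{x_3,x_4,[x_1,x_2,x_5]\}$. A homomorphism of compatible 3-Lie algebras is a linear map preserving both 3-brackets. Infinitesimal deformations: for $\omega_1,\omega_2\in\mathrm{Hom}(\wedge^3\mathfrak{g},\mathfrak{g})$ put $[x,y,z]_t=[x,y,z]+t\omega_1(x,y,z)$ and $\{x,y,z\}_t=\{x,y,z\}+t\omega_2(x,y,z)$. If for any $t$, $(\mathfrak{g},[\cdot,\cdot,\cdot]_t,\{\cdot,\cdot,\cdot\}_t)$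 is still a compatible 3-Lie algebra structure modulo $t^2$ (the defining identities hold modulo $t^2$), then $(\omega_1,\omega_2)$ is said to generate an infinitesimal deformation of $(\mathfrak{g},[\cdot,\cdot,\cdot],\{\cdot,\cdot,\cdot\})$. Two infinitesimal deformations generated by $(\omega_1,\omega_2)$ and $(\omega'_1,\omega'_2)$ are equivalent if there exists $N\in\mathfrak{gl}(\mathfrak{g})$ such that $\mathrm{Id}+tN:(\mathfrak{g},[\cdot,\cdot,\cdot]_t,\{\cdot,\cdot,\cdot\}_t)\to(\mathfrak{g},[\cdot,\cdot,\cdot]'_t,\{\cdot,\cdot,\cdot\}'_t)$ is a compatible 3-Lie algebra homomorphism modulo $t^2$. Cohomology in low degrees: write $\pi_1=[\cdot,\cdot,\cdot]$, $\pi_2=\{\cdot,\cdot,\cdot\}$. For $f\in\mathrm{Hom}(\mathfrak{g},\mathfrak{g})$ and $P,Q\in\mathrm{Hom}(\wedge^3\mathfrak{g},\mathfrak{g})$ set $[P,f]_{\mathrm{3Lie}}(x,y,z)=P(fx,y,z)+P(x,fy,z)+P(x,y,fz)-f(P(x,y,z))$ and $[P,Q]_{\mathrm{3Lie}}(x_1,\dots,x_5)=P(Q(x_1,x_2,x_3),x_4,x_5)+P(x_3,Q(x_1,x_2,x_4),x_5)+P(x_3,x_4,Q(x_1,x_2,x_5))-P(x_1,x_2,Q(x_3,x_4,x_5))+Q(P(x_1,x_2,x_3),x_4,x_5)+Q(x_3,P(x_1,x_2,x_4),x_5)+Q(x_3,x_4,P(x_1,x_2,x_5))-Q(x_1,x_2,P(x_3,x_4,x_5))$.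 The 1-cochains are $\mathrm{Hom}(\mathfrak{g},\mathfrak{g})$, the 2-cochains are $\mathrm{Hom}(\wedge^3\mathfrak{g},\mathfrak{g})^{\oplus2}$, and $\mathbb{d}^1f=([\pi_1,f]_{\mathrm{3Lie}},[\pi_2,f]_{\mathrm{3Lie}})$, $\mathbb{d}^2(\omega_1,\omega_2)=-([\pi_1,\omega_1]_{\mathrm{3Lie}},\ [\pi_2,\omega_1]_{\mathrm{3Lie}}+[\pi_1,\omega_2]_{\mathrm{3Lie}},\ [\pi_2,\omega_2]_{\mathrm{3Lie}})$. One has $\mathbb{d}^2\circ\mathbb{d}^1=0$ and $\mathcal{H}^2(\mathfrak{g},\mathfrak{g})=\ker\mathbb{d}^2/\mathrm{im}\,\mathbb{d}^1$. *)

(* Defs.v *)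
From HB Require Import structures.
From mathcomp Require Import all_boot all_order all_algebra.
From mathcomp Require Import boolp functions ring generic_quotient ring_quotient.
Set Implicit Arguments.
Unset Strict Implicit.
Unset Printing Implicit Defensive.
Import GRing.Theory.
Local Open Scope ring_scope.
Local Open Scope quotient_scope.

Section Coordinates.
Variables (K : fieldType) (V : vectType K).

Definition vcoord i : V -> K := coord (vbasis {:V}) i.

Fact vcoord_inj u v : (forall i, vcoord i u = vcoord i v) -> u = v.
Proof.
move=> uv; rewrite (coord_vbasis (memvf u)) (coord_vbasis (memvf v)).
by apply: eq_bigr => i _; congr (_ *: _); exact: uv.
Qed.

Fact vcoordD i u v : vcoord i (u + v) = vcoord i u + vcoord i v.
Proof. exact: linearD. Qed.

Fact vcoordN i u : vcoord i (- u) = - vcoord i u.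
Proof. exact: linearN. Qed.

Fact vcoordZ i a u : vcoord i (a *: u) = a * vcoord i u.
Proof. exact: linearZ. Qed.

Fact vcoord0 i : vcoord i 0 = 0.
Proof. exact: linear0. Qed.

End Coordinates.

Ltac lmod_ring :=
  apply: vcoord_inj => i; rewrite ?(vcoordD, vcoordN, vcoordZ, vcoord0); ring.

(* Hom(∧³V, V), realised as the skew-symmetric trilinear maps V³ -> V; the    *)
(* vector space structure is the pointwise one.                               *)
Section Skew3.
Variables (K : fieldType) (V : vectType K).
Implicit Types F : V -> V -> V -> V.

Definition trilinear F : Prop :=
  [/\ forall y z, linear (fun x => F x y z),
      forall x z, linear (fun y => F x y z)
    & forall x y, linear (fun z => F x y z)].

Definition skew_symmetric F : Prop := forall x y z,
  F y x z = - F x y z /\ F x z y = - F x y z.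

Definition is_skew3 : {pred V -> V -> V -> V} :=
  fun F => `[< trilinear F /\ skew_symmetric F >].

Lemma is_skew3P F : reflect (trilinear F /\ skew_symmetric F) (F \in is_skew3).
Proof. exact: asboolP. Qed.

Fact is_skew3_submod : submod_closed is_skew3.
Proof.
split.
  apply/is_skew3P; split; first by split=> u v a b c; rewrite /= scaler0 addr0.
  by move=> x y z; rewrite oppr0.
move=> k F G /is_skew3P[[F1 F2 F3] F4] /is_skew3P[[G1 G2 G3] G4].
have E x y z : (k *: F + G) x y z = k *: F x y z + G x y z by [].
apply/is_skew3P; split; last first.
  by move=> x y z; rewrite !E; have [-> ->] := F4 x y z; have [-> ->] := G4 x y z;
     split; lmod_ring.
by split=> u v a b c; rewrite !E;
   rewrite ?(F1 u v) ?(G1 u v) ?(F2 u v) ?(G2 u v) ?(F3 u v) ?(G3 u v);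
   lmod_ring.
Qed.

HB.instance Definition _ :=
  GRing.isSubmodClosed.Build K (V -> V -> V -> V) is_skew3 is_skew3_submod.

Record skew3 := Skew3 {
  skew3_fun :> V -> V -> V -> V;
  skew3_funP : skew3_fun \in is_skew3 }.

HB.instance Definition _ := [isSub for skew3_fun].
HB.instance Definition _ := [Choice of skew3 by <:].
HB.instance Definition _ := [SubChoice_isSubLmodule of skew3 by <:].

Lemma skew3Dl (A : skew3) u v y z : A (u + v) y z = A u y z + A v y z.
Proof.
have /is_skew3P[[A1 _ _] _] := skew3_funP A.
by have := A1 y z 1 u v; rewrite !scale1r.
Qed.

Lemma skew3Dm (A : skew3) u v y z : A y (u + v) z = A y u z + A y v z.
Proof.
have /is_skew3P[[_ A1 _] _] := skew3_funP A.
by have := A1 y z 1 u v; rewrite !scale1r.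
Qed.

Lemma skew3Dr (A : skew3) u v y z : A y z (u + v) = A y z u + A y z v.
Proof.
have /is_skew3P[[_ _ A1] _] := skew3_funP A.
by have := A1 y z 1 u v; rewrite !scale1r.
Qed.

Lemma skew3Nl (A : skew3) u y z : A (- u) y z = - A u y z.
Proof.
by apply/eqP; rewrite -addr_eq0 -skew3Dl addNr -[A _ _ _](addrK (A 0 y z));
   rewrite -skew3Dl addr0 subrr.
Qed.

Lemma skew3Nm (A : skew3) u y z : A y (- u) z = - A y u z.
Proof.
by apply/eqP; rewrite -addr_eq0 -skew3Dm addNr -[A _ _ _](addrK (A y 0 z));
   rewrite -skew3Dm addr0 subrr.
Qed.

Lemma skew3Nr (A : skew3) u y z : A y z (- u) = - A y z u.
Proof.
by apply/eqP; rewrite -addr_eq0 -skew3Dr addNr -[A _ _ _](addrK (A y z 0));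
   rewrite -skew3Dr addr0 subrr.
Qed.

End Skew3.

Section Compatible3Lie.
Variables (K : fieldType) (V : vectType K).
Implicit Types (P Q : V -> V -> V -> V) (x : V).

Definition fundamental_lhs P x1 x2 x3 x4 x5 : V := P x1 x2 (P x3 x4 x5).

Definition fundamental_rhs P x1 x2 x3 x4 x5 : V :=
  P (P x1 x2 x3) x4 x5 + P x3 (P x1 x2 x4) x5 + P x3 x4 (P x1 x2 x5).

Definition compatible_lhs P Q x1 x2 x3 x4 x5 : V :=
  P x1 x2 (Q x3 x4 x5) + Q x1 x2 (P x3 x4 x5).

Definition compatible_rhs P Q x1 x2 x3 x4 x5 : V :=
  P (Q x1 x2 x3) x4 x5 + Q (P x1 x2 x3) x4 x5
  + P x3 (Q x1 x2 x4) x5 + Q x3 (P x1 x2 x4) x5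
  + P x3 x4 (Q x1 x2 x5) + Q x3 x4 (P x1 x2 x5).

Definition is_3Lie (P : skew3 V) : Prop := forall x1 x2 x3 x4 x5,
  fundamental_lhs P x1 x2 x3 x4 x5 = fundamental_rhs P x1 x2 x3 x4 x5.

Definition are_compatible (P Q : skew3 V) : Prop := forall x1 x2 x3 x4 x5,
  compatible_lhs P Q x1 x2 x3 x4 x5 = compatible_rhs P Q x1 x2 x3 x4 x5.

Record compatible_3Lie := Compatible3Lie {
  pi1 : skew3 V;
  pi2 : skew3 V;
  pi1_3Lie : is_3Lie pi1;
  pi2_3Lie : is_3Lie pi2;
  pi12_compatible : are_compatible pi1 pi2 }.

End Compatible3Lie.

Section Deformations.
Variables (K : fieldType) (V : vectType K).

(* Congruence modulo t² of V-valued functions of the parameter t in K: the    *)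
(* difference is t² times a polynomial in t with coefficients in V.           *)
Definition eq_mod_t2 (F G : K -> V) : Prop :=
  exists c : seq V, forall t : K,
    F t - G t = t ^+ 2 *: \sum_(i < size c) t ^+ i *: c`_i.

Definition deformed (P w : skew3 V) (t : K) : skew3 V := P + t *: w.

Definition is_3Lie_mod_t2 (P : K -> skew3 V) : Prop :=
  forall x1 x2 x3 x4 x5 : V,
    eq_mod_t2 (fun t => fundamental_lhs (P t) x1 x2 x3 x4 x5)
              (fun t => fundamental_rhs (P t) x1 x2 x3 x4 x5).

Definition are_compatible_mod_t2 (P Q : K -> skew3 V) : Prop :=
  forall x1 x2 x3 x4 x5 : V,
    eq_mod_t2 (fun t => compatible_lhs (P t) (Q t) x1 x2 x3 x4 x5)
              (fun t => compatible_rhs (P t) (Q t) x1 x2 x3 x4 x5).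

Definition preserves_mod_t2 (phi : K -> 'End(V)) (P Q : K -> skew3 V) : Prop :=
  forall x y z : V,
    eq_mod_t2 (fun t => phi t (P t x y z))
              (fun t => Q t (phi t x) (phi t y) (phi t z)).

Variable g : compatible_3Lie V.

Definition infinitesimal_deformation (w : skew3 V * skew3 V) : Prop :=
  [/\ is_3Lie_mod_t2 (deformed (pi1 g) w.1),
      is_3Lie_mod_t2 (deformed (pi2 g) w.2)
    & are_compatible_mod_t2 (deformed (pi1 g) w.1) (deformed (pi2 g) w.2)].

Definition equivalent_deformations (w w' : skew3 V * skew3 V) : Prop :=
  exists N : 'End(V), let phi := fun t : K => (\1 + t *: N)%VF in
    preserves_mod_t2 phi (deformed (pi1 g) w.1) (deformed (pi1 g) w'.1) /\
    preserves_mod_t2 phi (deformed (pi2 g) w.2) (deformed (pi2 g) w'.2).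

End Deformations.

(* The values of d2 are triples of arbitrary 5-ary maps: for its kernel, only *)
(* the vanishing of the three components matters.                             *)
Definition map5 (K : fieldType) (V : vectType K) := V -> V -> V -> V -> V -> V.

HB.instance Definition _ (K : fieldType) (V : vectType K) :=
  GRing.Lmodule.copy (map5 V) (V -> V -> V -> V -> V -> V).

Section Cohomology.
Variables (K : fieldType) (V : vectType K).

Section Brackets.
Variables (P Q : skew3 V) (f : 'End(V)).

Definition bracket1_fun (x y z : V) : V :=
  P (f x) y z + P x (f y) z + P x y (f z) - f (P x y z).

Fact bracket1_subproof : bracket1_fun \in @is_skew3 K V.
Proof.
have /is_skew3P[[P1 P2 P3] P4] := skew3_funP P.
apply/is_skew3P; split; last first.
  move=> x y z; rewrite /bracket1_fun.
  have [-> ->] := P4 x y z; have [-> ->] := P4 (f x) y z.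
  have [-> ->] := P4 x (f y) z; have [-> ->] := P4 x y (f z).
  by rewrite linearN; split; lmod_ring.
split=> u v a b c; rewrite /bracket1_fun !linearP.
- by rewrite !(P1 _ _ a) linearP; lmod_ring.
- by rewrite !(P2 _ _ a) linearP; lmod_ring.
- by rewrite !(P3 _ _ a) linearP; lmod_ring.
Qed.

Definition bracket1 : skew3 V := Skew3 bracket1_subproof.

Definition bracket2 : map5 V := fun x1 x2 x3 x4 x5 =>
    P (Q x1 x2 x3) x4 x5 + P x3 (Q x1 x2 x4) x5
  + P x3 x4 (Q x1 x2 x5) - P x1 x2 (Q x3 x4 x5)
  + Q (P x1 x2 x3) x4 x5 + Q x3 (P x1 x2 x4) x5
  + Q x3 x4 (P x1 x2 x5) - Q x1 x2 (P x3 x4 x5).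

End Brackets.

Variable g : compatible_3Lie V.

Definition d1 (f : 'End(V)) : skew3 V * skew3 V :=
  (bracket1 (pi1 g) f, bracket1 (pi2 g) f).

Definition d2 (w : skew3 V * skew3 V) :
    map5 V * map5 V * map5 V :=
  - (bracket2 (pi1 g) w.1,
     bracket2 (pi2 g) w.1 + bracket2 (pi1 g) w.2,
     bracket2 (pi2 g) w.2).

Section CoboundaryIsCocycle.
Variables (P Q : skew3 V) (f : 'End(V)).

Let half (A B : V -> V -> V -> V) (x1 x2 x3 x4 x5 : V) : V :=
    A (B x1 x2 x3) x4 x5 + A x3 (B x1 x2 x4) x5
  + A x3 x4 (B x1 x2 x5) - A x1 x2 (B x3 x4 x5).

Let halfE (A B : skew3 V) x1 x2 x3 x4 x5 :
  half A (bracket1 B f) x1 x2 x3 x4 x5 + half (bracket1 A f) B x1 x2 x3 x4 x5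
  = half A B (f x1) x2 x3 x4 x5 + half A B x1 (f x2) x3 x4 x5
    + half A B x1 x2 (f x3) x4 x5 + half A B x1 x2 x3 (f x4) x5
    + half A B x1 x2 x3 x4 (f x5) - f (half A B x1 x2 x3 x4 x5).
Proof.
rewrite /half /= /bracket1_fun.
rewrite !(skew3Dl, skew3Dm, skew3Dr, skew3Nl, skew3Nm, skew3Nr, linearD, linearN).
lmod_ring.
Qed.

Let bracket2E (A B : skew3 V) x1 x2 x3 x4 x5 :
  bracket2 A B x1 x2 x3 x4 x5
  = half A B x1 x2 x3 x4 x5 + half B A x1 x2 x3 x4 x5.
Proof. by rewrite /half /bracket2; lmod_ring. Qed.

Lemma bracket2_bracket1 : is_3Lie P ->
  bracket2 P (bracket1 P f) = 0.
Proof.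
move=> P3; have h0 x1 x2 x3 x4 x5 : half P P x1 x2 x3 x4 x5 = 0.
  have := P3 x1 x2 x3 x4 x5; rewrite /fundamental_lhs /fundamental_rhs /half.
  by move=> ->; rewrite subrr.
apply/funext=> x1; apply/funext=> x2; apply/funext=> x3.
apply/funext=> x4; apply/funext=> x5.
move: (halfE P P x1 x2 x3 x4 x5); rewrite !h0 linear0 subr0 !addr0.
by rewrite -bracket2E; apply.
Qed.

Lemma bracket2_bracket1C : are_compatible P Q ->
  bracket2 Q (bracket1 P f) + bracket2 P (bracket1 Q f) = 0.
Proof.
move=> PQ; have h0 x1 x2 x3 x4 x5 :
    half Q P x1 x2 x3 x4 x5 = - half P Q x1 x2 x3 x4 x5.
  apply/eqP; rewrite -addr_eq0; have := PQ x1 x2 x3 x4 x5.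
  move/eqP; rewrite eq_sym -subr_eq0 => /eqP <-; apply/eqP.
  by rewrite /half /compatible_lhs /compatible_rhs; lmod_ring.
apply/funext=> x1; apply/funext=> x2; apply/funext=> x3.
apply/funext=> x4; apply/funext=> x5.
have E1 := halfE Q P x1 x2 x3 x4 x5; rewrite !h0 linearN in E1.
have E2 := halfE P Q x1 x2 x3 x4 x5.
transitivity (bracket2 Q (bracket1 P f) x1 x2 x3 x4 x5
              + bracket2 P (bracket1 Q f) x1 x2 x3 x4 x5); first by [].
transitivity (0 : V); last by [].
rewrite !bracket2E [X in _ + X]addrC addrACA E1.
by rewrite [X in _ + X]addrC E2; lmod_ring.
Qed.

End CoboundaryIsCocycle.

Let triple_eq0 (A B C : zmodType) (a : A) (b : B) (c : C) :
  - (a, b, c) = 0 <-> [/\ a = 0, b = 0 & c = 0].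
Proof.
split=> [/eqP | [-> -> ->]]; last by rewrite oppr0.
by rewrite oppr_eq0 => /eqP [-> -> ->].
Qed.

Lemma d2_eq0 (w : skew3 V * skew3 V) : d2 w = 0 <->
  [/\ bracket2 (pi1 g) w.1 = 0,
      bracket2 (pi2 g) w.1 + bracket2 (pi1 g) w.2 = 0
    & bracket2 (pi2 g) w.2 = 0].
Proof. exact: triple_eq0. Qed.

Lemma d2_d1 (f : 'End(V)) : d2 (d1 f) = 0.
Proof.
apply/d2_eq0; split.
- exact/bracket2_bracket1/pi1_3Lie.
- exact/bracket2_bracket1C/pi12_compatible.
- exact/bracket2_bracket1/pi2_3Lie.
Qed.

Let bracket1B (P : skew3 V) (f f' : 'End(V)) :
  bracket1 P (f - f') = bracket1 P f - bracket1 P f'.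
Proof.
apply: val_inj; apply/funext=> x; apply/funext=> y; apply/funext=> z.
transitivity (bracket1_fun P f x y z - bracket1_fun P f' x y z); last by [].
rewrite /= /bracket1_fun !(add_lfunE, opp_lfunE).
by rewrite !(skew3Dl, skew3Dm, skew3Dr, skew3Nl, skew3Nm, skew3Nr); lmod_ring.
Qed.

Let d1B (f f' : 'End(V)) : d1 (f - f') = d1 f - d1 f'.
Proof. by rewrite /d1 !bracket1B. Qed.

Let bracket2B (P Q Q' : skew3 V) :
  bracket2 P (Q - Q') = bracket2 P Q - bracket2 P Q'.
Proof.
apply/funext=> x1; apply/funext=> x2; apply/funext=> x3.
apply/funext=> x4; apply/funext=> x5.
transitivity (bracket2 P Q x1 x2 x3 x4 x5 - bracket2 P Q' x1 x2 x3 x4 x5);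
  last by [].
have E x y z : (Q - Q') x y z = Q x y z - Q' x y z by [].
rewrite /bracket2 !E !(skew3Dl, skew3Dm, skew3Dr, skew3Nl, skew3Nm, skew3Nr).
lmod_ring.
Qed.

Definition is_cocycle : {pred skew3 V * skew3 V} := fun w => `[< d2 w = 0 >].

Lemma is_cocycleP w : reflect (d2 w = 0) (w \in is_cocycle).
Proof. exact: asboolP. Qed.

Fact is_cocycle_zmod : zmod_closed is_cocycle.
Proof.
have bracket20 (P : skew3 V) : bracket2 P 0 = 0.
  by have := bracket2B P 0 0; rewrite !subrr.
split; first by apply/is_cocycleP/d2_eq0; rewrite !bracket20 addr0; split.
move=> u v /is_cocycleP/d2_eq0[u1 u2 u3] /is_cocycleP/d2_eq0[v1 v2 v3].
have E1 : (u - v).1 = u.1 - v.1 by [].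
have E2 : (u - v).2 = u.2 - v.2 by [].
apply/is_cocycleP/d2_eq0; rewrite E1 E2.
rewrite (bracket2B (pi1 g) u.1) (bracket2B (pi2 g) u.1).
rewrite (bracket2B (pi1 g) u.2) (bracket2B (pi2 g) u.2).
by rewrite addrACA -opprD u1 u2 u3 v1 v2 v3 subrr; split.
Qed.

HB.instance Definition _ :=
  GRing.isZmodClosed.Build (skew3 V * skew3 V)%type is_cocycle is_cocycle_zmod.

Record cocycle := Cocycle {
  cocycle_val :> skew3 V * skew3 V;
  cocycleP : cocycle_val \in is_cocycle }.

HB.instance Definition _ := [isSub for cocycle_val].
HB.instance Definition _ := [Choice of cocycle by <:].
HB.instance Definition _ := [SubChoice_isSubZmodule of cocycle by <:].

Definition is_coboundary : {pred cocycle} :=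
  fun w => `[< exists f : 'End(V), d1 f = val w >].

Lemma is_coboundaryP w :
  reflect (exists f : 'End(V), d1 f = val w) (w \in is_coboundary).
Proof. exact: asboolP. Qed.

Fact is_coboundary_zmod : zmod_closed is_coboundary.
Proof.
split.
  by apply/is_coboundaryP; exists 0; have := d1B 0 0; rewrite !subrr.
move=> u v /is_coboundaryP[f fu] /is_coboundaryP[f' fv].
by apply/is_coboundaryP; exists (f - f'); rewrite d1B fu fv.
Qed.

HB.instance Definition _ :=
  GRing.isZmodClosed.Build cocycle is_coboundary is_coboundary_zmod.

Definition H2 := @Quotient.quot cocycle is_coboundary.

Definition cohomology_class (w : skew3 V * skew3 V) (w0 : d2 w = 0) : H2 :=
  \pi_H2 (Cocycle (introT (is_cocycleP w) w0)).

End Cohomology.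

(* Main.v *)
Require Import Defs.
From mathcomp Require Import all_boot all_order all_algebra.
From mathcomp Require Import boolp functions ring generic_quotient ring_quotient.
Import GRing.Theory.
Local Open Scope ring_scope.
Local Open Scope quotient_scope.

(** A deformation is polynomial in t, and the ground field is infinite, so a
    congruence modulo t^2 holds exactly when the coefficients of t^0 and t^1
    agree ([eq_mod_t2P]).  Applying this to each defining identity turns the
    whole theorem into a computation of first-order terms.

    In the fundamental identity for [P + t w], and in the compatibility
    identity for [P + t w] and [Q + t w'], the constant term is the identity
    satisfied by the undeformed brackets, and the coefficient of t is, up to
    sign, [bracket2 P w], respectively [bracket2 Q w + bracket2 P w']
    ([is_3Lie_mod_t2P], [are_compatible_mod_t2P]).  These are the three
    components of [d2], so an infinitesimal deformation is closed.

    For [Id + t N] to carry [P + t w] to [P + t w'] modulo t^2, the constant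
    terms agree trivially and the coefficient of t gives
    [w - w' = bracket1 P N] ([preserves_mod_t2P]).  Asking this of both
    brackets with the same [N] says that the difference of the two cocycles is
    the coboundary [d1 N], which is what equality in the quotient means
    ([cohomology_classP]). *)

Section FirstOrder.
Variables (K : closedFieldType) (V : vectType K).

(** Over an algebraically closed field every nonzero polynomial has a non-root;
    this is where the infinitude of the field enters. *)
Lemma horner_eq0_poly0 (p : {poly K}) : (forall t, p.[t] = 0) -> p = 0.
Proof.
move=> p0; apply/eqP; apply: contraT => /closed_nonrootP[t].
by rewrite rootE p0 eqxx.
Qed.

(** Reads off the first two coefficients of a congruence modulo t^2.  The
    expansion of the difference is supplied by the user, including its
    remainder [c]; in coordinates, the hypothesis makes a polynomial vanish at
    every point, so that all its coefficients vanish. *)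
Lemma eq_mod_t2P (F G : K -> V) (a b : V) (c : seq V) :
  (forall t, F t - G t
     = a + t *: b + t ^+ 2 *: \sum_(i < size c) t ^+ i *: c`_i) ->
  eq_mod_t2 F G <-> a = 0 /\ b = 0.
Proof.
move=> FG; split=> [[d Fd] | [a0 b0]]; last first.
  by exists c => t; rewrite FG a0 b0 scaler0 !add0r.
(* The i-th coordinate of the expansion, minus t^2 times the remainder [d]
   provided by the congruence, is the value at t of the polynomial [p i]. *)
pose rest i (s : seq V) := \poly_(j < size s) vcoord i s`_j.
pose p i := (vcoord i a)%:P + 'X * ((vcoord i b)%:P
              + 'X * (rest i c - rest i d)).
have vcoord_rest i (s : seq V) t :
    vcoord i (\sum_(j < size s) t ^+ j *: s`_j) = (rest i s).[t].
  rewrite horner_poly /vcoord linear_sum /=.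
  by apply: eq_bigr => j _; rewrite linearZ /= mulrC.
have p0 i : p i = 0.
  apply: horner_eq0_poly0 => t.
  have /(congr1 (vcoord i)) := etrans (esym (FG t)) (Fd t).
  rewrite !vcoordD !vcoordZ !vcoord_rest => /eqP; rewrite -subr_eq0 => /eqP E.
  by rewrite /p !hornerE /= -[RHS]E; ring.
split; apply: vcoord_inj => i; rewrite vcoord0.
  have := congr1 (fun q : {poly K} => q`_0) (p0 i).
  by rewrite /p coefD coefC coefXM coef0 addr0.
have := congr1 (fun q : {poly K} => q`_1) (p0 i).
by rewrite /p coefD coefC coefXM coefD coefC coefXM coef0 add0r addr0.
Qed.

End FirstOrder.

Section Skew3Linearity.
Variables (K : fieldType) (V : vectType K) (P : skew3 V).

Lemma skew3Zl k x y z : P (k *: x) y z = k *: P x y z.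
Proof.
have /is_skew3P[[P1 _ _] _] := skew3_funP P.
exact: (GRing.scalable_linear (P1 y z)).
Qed.

Lemma skew3Zm k x y z : P x (k *: y) z = k *: P x y z.
Proof.
have /is_skew3P[[_ P2 _] _] := skew3_funP P.
exact: (GRing.scalable_linear (P2 x z)).
Qed.

Lemma skew3Zr k x y z : P x y (k *: z) = k *: P x y z.
Proof.
have /is_skew3P[[_ _ P3] _] := skew3_funP P.
exact: (GRing.scalable_linear (P3 x y)).
Qed.

Lemma deformedE (w : skew3 V) t x y z :
  deformed P w t x y z = P x y z + t *: w x y z.
Proof. by []. Qed.

Lemma skew3P (Q : skew3 V) : (forall x y z, P x y z = Q x y z) -> P = Q.
Proof.
move=> PQ; apply: val_inj.
by apply/funext => x; apply/funext => y; apply/funext => z; exact: PQ.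
Qed.

End Skew3Linearity.

Definition skew3_linear :=
  (skew3Dl, skew3Dm, skew3Dr, skew3Zl, skew3Zm, skew3Zr).

Section FirstOrderTerms.
Variables (K : closedFieldType) (V : vectType K).
Implicit Types (P Q w : skew3 V) (N : 'End(V)).

(** In the expansion of the fundamental identity of [P + t w], the coefficient
    of t collects the terms with one [P] and one [w], and the coefficient of
    t^2 is the defect of the fundamental identity of [w] itself. *)
Lemma is_3Lie_mod_t2P P w : is_3Lie P ->
  is_3Lie_mod_t2 (deformed P w) <-> bracket2 P w = 0.
Proof.
move=> P3.
have expand x1 x2 x3 x4 x5 :
    eq_mod_t2 (fun t => fundamental_lhs (deformed P w t) x1 x2 x3 x4 x5)
              (fun t => fundamental_rhs (deformed P w t) x1 x2 x3 x4 x5)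
    <-> (0 : V) = 0 /\ - bracket2 P w x1 x2 x3 x4 x5 = 0.
  apply: (eq_mod_t2P _ _ _ _ _ _ [:: fundamental_lhs w x1 x2 x3 x4 x5
                            - fundamental_rhs w x1 x2 x3 x4 x5]) => t.
  move: (P3 x1 x2 x3 x4 x5); rewrite /fundamental_lhs /fundamental_rhs => P3x.
  rewrite !deformedE big_ord1 /= !skew3_linear P3x /bracket2.
  by lmod_ring.
split=> [H | H x1 x2 x3 x4 x5].
  do 5!apply/funext=> ?; apply: oppr_inj; rewrite [RHS]oppr0.
  exact: ((expand _ _ _ _ _).1 (H _ _ _ _ _)).2.
by apply/expand; rewrite H oppr0.
Qed.

(** The compatibility identity is bilinear in the two brackets, so its
    coefficient of t pairs [w] with [Q] and [P] with [w']; the coefficient of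
    t^2 is the compatibility defect of [w] and [w']. *)
Lemma are_compatible_mod_t2P P Q w (w' : skew3 V) : are_compatible P Q ->
  are_compatible_mod_t2 (deformed P w) (deformed Q w')
  <-> bracket2 Q w + bracket2 P w' = 0.
Proof.
move=> PQ.
have expand x1 x2 x3 x4 x5 :
    eq_mod_t2
      (fun t => compatible_lhs (deformed P w t) (deformed Q w' t) x1 x2 x3 x4 x5)
      (fun t => compatible_rhs (deformed P w t) (deformed Q w' t) x1 x2 x3 x4 x5)
    <-> (0 : V) = 0
        /\ - (bracket2 Q w x1 x2 x3 x4 x5 + bracket2 P w' x1 x2 x3 x4 x5) = 0.
  apply: (eq_mod_t2P _ _ _ _ _ _ [:: compatible_lhs w w' x1 x2 x3 x4 x5
                            - compatible_rhs w w' x1 x2 x3 x4 x5]) => t.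
  have := PQ x1 x2 x3 x4 x5; rewrite /compatible_lhs /compatible_rhs.
  move/(canRL (addrK _)) => PQx.
  rewrite !deformedE big_ord1 /= !skew3_linear PQx /bracket2.
  by lmod_ring.
split=> [H | H x1 x2 x3 x4 x5].
  do 5!apply/funext=> ?; apply: oppr_inj; rewrite [RHS]oppr0.
  exact: ((expand _ _ _ _ _).1 (H _ _ _ _ _)).2.
apply/expand; split=> //.
by rewrite -[X in - X]/((bracket2 Q w + bracket2 P w') x1 x2 x3 x4 x5) H oppr0.
Qed.

(** First-order terms of [(Id + t N) (P + t w)] against those of [P + t w']
    evaluated on arguments moved by [Id + t N]. *)
Lemma preserves_mod_t2P P w (w' : skew3 V) N :
  preserves_mod_t2 (fun t => (\1 + t *: N)%VF) (deformed P w) (deformed P w')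
  <-> w - w' = bracket1 P N.
Proof.
have expand x y z :
    eq_mod_t2
      (fun t => (\1 + t *: N)%VF (deformed P w t x y z))
      (fun t => deformed P w' t ((\1 + t *: N)%VF x) ((\1 + t *: N)%VF y)
                                ((\1 + t *: N)%VF z))
    <-> (0 : V) = 0 /\ w x y z - w' x y z - bracket1 P N x y z = 0.
  (* The difference has degree 4 in t; the three entries are its coefficients
     of t^2, t^3 and t^4. *)
  apply: (eq_mod_t2P _ _ _ _ _ _
    [:: N (w x y z) - (P (N x) (N y) z + P (N x) y (N z) + P x (N y) (N z))
          - (w' (N x) y z + w' x (N y) z + w' x y (N z));
        - P (N x) (N y) (N z)
          - (w' (N x) (N y) z + w' (N x) y (N z) + w' x (N y) (N z));
        - w' (N x) (N y) (N z)]) => t.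
  rewrite !deformedE !big_ord_recr big_ord0 /=.
  rewrite !(add_lfunE, scale_lfunE, id_lfunE) !skew3_linear !linearD !linearZ /=.
  by rewrite /bracket1_fun; lmod_ring.
split=> [H | H x y z].
  apply: skew3P => x y z; apply/eqP; rewrite -subr_eq0; apply/eqP.
  exact: ((expand x y z).1 (H x y z)).2.
by apply/expand; rewrite -H subrr.
Qed.

Lemma cohomology_classP (g : compatible_3Lie V) (w w' : skew3 V * skew3 V)
    (dw : d2 g w = 0) (dw' : d2 g w' = 0) :
  cohomology_class dw = cohomology_class dw' <-> exists f, d1 g f = w - w'.
Proof.
split=> [/eqP | H]; last apply/eqP; rewrite /cohomology_class /H2 -Quotient.idealrBE.
  by move/is_coboundaryP.
exact/is_coboundaryP.
Qed.

End FirstOrderTerms.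

Theorem theorem3p5 (K : closedFieldType) (charK : [pchar K] =i pred0)
    (V : vectType K) (g : compatible_3Lie V) :
  (forall w : skew3 V * skew3 V,
     infinitesimal_deformation g w -> d2 g w = 0) /\
  (forall (w w' : skew3 V * skew3 V),
     infinitesimal_deformation g w -> infinitesimal_deformation g w' ->
     forall (dw : d2 g w = 0) (dw' : d2 g w' = 0),
       equivalent_deformations g w w' <->
       cohomology_class dw = cohomology_class dw').
Proof.
split=> [w [w1 w2 w12] | [w1 w2] [w1' w2'] _ _ dw dw'].
  apply/d2_eq0; split.
  - exact: (is_3Lie_mod_t2P _ _ _ _ (pi1_3Lie g)).1 w1.
  - exact: (are_compatible_mod_t2P _ _ _ _ _ _ (pi12_compatible g)).1 w12.
  - exact: (is_3Lie_mod_t2P _ _ _ _ (pi2_3Lie g)).1 w2.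
rewrite cohomology_classP; split=> -[N].
  case=> /preserves_mod_t2P E1 /preserves_mod_t2P E2; exists N.
  by rewrite /d1 -E1 -E2.
move=> E; exists N; split.
  exact: (preserves_mod_t2P _ _ _ _ _ _).2 (esym (congr1 fst E)).
exact: (preserves_mod_t2P _ _ _ _ _ _).2 (esym (congr1 snd E)).
Qed.
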